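(* Let $p$ be a prime and $\alpha,\beta$ integers different from $1$, and assume that either $p>3$, or $p=3$ and neither $\alpha$ nor $\beta$ is congruent to $7$ modulo $9$. Let $m=v_p(\alpha-1)$, $n=v_p(\beta-1)$, $\ell=v_p(\alpha-\beta)$, and suppose $m\ge n=\ell>0$. Then $|G_p|=p^{4n+m}$, the nilpotency class of $G_p$ is $3$, $o(a)=p^{m+n}$, $o(b)=p^{2n}$ and $o(c)=p^{n}$.
   Context: $G(\alpha,\beta)=\langle A,B\mid A^{[A,B]}=A^{\alpha},\ B^{[B,A]}=B^{\beta}\rangle$ with $[x,y]=x^{-1}y^{-1}xy$, $y^x=x^{-1}yx$, and $C=[A,B]$. The group $G(\alpha,\beta)$ is finite and nilpotent, hence the direct product of its Sylow subgroups; $G_p$ denotes its Sylow $p$-subgroup and $a,b,c$ denote the images of $A,B,C$ under the canonical projection $G(\alpha,\beta)\to G_p$. $v_p$ is the $p$-adic valuation and $o(x)$ the order of $x$. *)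

(* Defs.v *)
From HB Require Import structures.
From mathcomp Require Import all_boot all_order all_algebra all_fingroup all_solvable.
Set Implicit Arguments. Unset Strict Implicit. Unset Printing Implicit Defensive.
Import GRing.Theory Num.Theory.

Local Open Scope group_scope.

Definition zexpg (gT : finGroupType) (x : gT) (z : int) : gT :=
  match z with
  | Posz n => x ^+ n
  | Negz n => x ^- n.+1
  end.

(* the defining relations of G(alpha,beta):
   A^[A,B] = A^alpha, B^[B,A] = B^beta, with [x,y] = x^-1 y^-1 x y
   (= mathcomp's [~ x, y]) and y^x = x^-1 y x (= mathcomp's y ^ x). *)
Definition Grels (gT : finGroupType) (x y : gT) (alpha beta : int) : Prop :=
  x ^ [~ x, y] = zexpg x alpha /\ y ^ [~ y, x] = zexpg y beta.

(* (gT, A, B) is (a copy of) the finitely presented group G(alpha,beta) with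
   A, B the images of the generators: gT is generated by A and B, the
   relations hold, and every pair of elements of any finite group satisfying
   the relations is the image of (A, B) under a homomorphism.  Since
   G(alpha,beta) is finite, this characterises it up to isomorphism. *)
Definition is_Gab (gT : finGroupType) (A B : gT) (alpha beta : int) : Prop :=
  [set: gT] = <<[set A; B]>> /\ Grels A B alpha beta /\
  forall (hT : finGroupType) (x y : hT), Grels x y alpha beta ->
    exists f : {morphism [set: gT] >-> hT}, f A = x /\ f B = y.

(* Main.v *)
(* Write c = [a, b] and let geo x k = 1 + x + ... + x^(k-1).  Since a^b = a c and
   c normalizes <a> and <b>, one has (a^k)^b = c^k a^(alpha geo alpha k), and
   conjugating a^(alpha^e) = a^(c^e) by b expresses
   c^(alpha^e) a^-g c^-(beta^e), with g = gap alpha (alpha^e), as a power of a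
   conjugate of b; conjugating once more by c puts a^((alpha - 1) g) in the
   centre.  Letting e vary, every prime dividing o(a) divides alpha - 1, which
   yields a nontrivial centre for every nontrivial quotient; so G is nilpotent
   and its Sylow p-subgroup is generated by a, b subject to the same relations.
   For e = 1 the relation reads c^(alpha - beta) a^x = b^y with v(x) >= 2m and
   v(y) = 2n: this is where the congruences modulo 9 matter when p = 3.
   Combining it with its conjugates gives a^(p^(m+n)) = b^(p^(2n)) =
   c^(p^n) = 1.  Then a^(p^m) and b^(p^n) are central, c is central modulo
   them, and this bounds the class by 3 and the order by p^(4n+m).
   Conversely, the quotient by <b^(p^n)> is realized by permutations of
   Z/p^(m+n) x Z/p^n x Z/p^n, and exchanging a and b gives the order of b. *)
Require Import Defs.
From HB Require Import structures.
From mathcomp Require Import all_boot all_order all_algebra all_fingroup all_solvable.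
From mathcomp Require Import zify ring.
Import GRing.Theory Num.Theory.

Set Implicit Arguments.
Unset Strict Implicit.
Unset Printing Implicit Defensive.

(** * Truncated geometric sums *)

Definition geo (x k : nat) : nat := \sum_(i < k) x ^ i.

Lemma geoS x k : geo x k.+1 = 1 + x * geo x k.
Proof.
rewrite /geo big_ord_recl expn0 big_distrr /=; congr (_ + _).
by apply: eq_bigr => i _; rewrite expnS.
Qed.

Lemma geo0 x : geo x 0 = 0.
Proof. by rewrite /geo big_ord0. Qed.

Lemma geo_exp d k : d.+1 ^ k = 1 + d * geo d.+1 k.
Proof. by elim: k => [|k IH]; rewrite ?geo0 ?expn0 ?geoS ?expnS ?IH; nia. Qed.

Lemma geoD x k j : geo x (k + j) = geo x k + x ^ k * geo x j.
Proof.
elim: k => [|k IH]; first by rewrite geo0 expn0 mul1n.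
by rewrite addSn !geoS IH expnS; nia.
Qed.

Lemma geoM x k j : geo x (k * j) = geo x k * geo (x ^ k) j.
Proof.
elim: j => [|j IH]; first by rewrite muln0 !geo0 muln0.
by rewrite mulnS geoD IH geoS; nia.
Qed.

(** The binomial expansion of [(d.+1 ^ k - 1) / d], with its tail collected in [z] so that neither
    subtraction nor division occurs. *)
Lemma geo_trunc d k :
  exists z, geo d.+1 k = k + 'C(k, 2) * d + 'C(k, 3) * d ^ 2 + d ^ 3 * z.
Proof.
elim: k => [|k [z IH]]; first by exists 0; rewrite geo0 !bin0n; lia.
exists ('C(k, 3) + d.+1 * z); rewrite geoS IH !binS bin1; ring.
Qed.

(** Induction on [e]: [geoM] splits off one factor [p] of [k]. As [p] is odd it divides ['C(p, 2)],
    so [geo D.+1 p] is [p] modulo [p ^ (e + n).+1] when [p ^ (e + n)] divides [D]. *)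
Lemma geo_pfactor p n d e k : prime p -> odd p -> 0 < n ->
  p ^ n %| d -> p ^ e %| k -> exists u, geo d.+1 k = k + p ^ (e + n) * u.
Proof.
move=> p_pr p_odd n_gt0 /dvdnP[w ->].
elim: e k => [|e IH] k.
  move=> _; have [z ->] := geo_trunc (w * p ^ n) k; rewrite add0n.
  exists ('C(k, 2) * w + 'C(k, 3) * w ^ 2 * p ^ n + w ^ 3 * p ^ n * p ^ n * z).
  by ring.
rewrite expnS => /dvdnP[v ->]; have [|u IHu] := IH (v * p ^ e).
  exact: dvdn_mull.
have -> : v * (p * p ^ e) = v * p ^ e * p by ring.
rewrite geoM geo_exp IHu; set D := (X in (1 + X)).
have [v' Dv] : exists v', D = p ^ (e + n) * v'.
  exists (w * (v + p ^ n * u)); rewrite /D expnD; ring.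
have [z ->] : exists z, geo D.+1 p = p + 'C(p, 2) * D + D ^ 2 * z.
  by have [z ->] := geo_trunc D p; exists ('C(p, 3) + D * z); ring.
have [h ->] : exists h, 'C(p, 2) = p * h.
  by exists p.-1./2; rewrite bin2odd.
rewrite Dv; have [n' ->] : exists n', n = n'.+1 by exists n.-1; rewrite prednK.
rewrite !addnS !addSn !expnS.
have -> : p ^ (e + n') = p ^ e * p ^ n' by rewrite expnD.
exists (v * h * p ^ e * v' + v * p ^ e * p ^ e * p ^ n' * v' ^ 2 * z
  + u * (1 + h * (p * p ^ e * p ^ n' * v'))
  + u * p ^ e * p ^ n' * p ^ e * p ^ n' * p * v' ^ 2 * z).
ring.
Qed.

(** Each factor [q] of the exponent gains a factor [q]. Here [q] may be 2, since the nilpotency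
    argument meets every prime dividing the order of a generator. *)
Lemma exp_pfactor q d e k : prime q -> q %| d -> q ^ e %| k ->
  exists u, d.+1 ^ k = 1 + q ^ e.+1 * u.
Proof.
move=> q_pr /dvdnP[w ->]; elim: e k => [|e IH] k.
  by move=> _; exists (w * geo (w * q).+1 k); rewrite geo_exp expn1; ring.
rewrite expnS => /dvdnP[v ->]; have [|u IHu] := IH (v * q ^ e).
  exact: dvdn_mull.
have -> : v * (q * q ^ e) = v * q ^ e * q by ring.
rewrite expnM IHu add1n geo_exp; set D := q ^ e.+1 * u.
have [z ->] := geo_trunc D q.
exists (u * (1 + 'C(q, 2) * (q ^ e * u) + 'C(q, 3) * D * (q ^ e * u)
             + D ^ 2 * (q ^ e * u) * z)).
rewrite /D !expnS; ring.
Qed.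

(* The exponent in [a ^ (b ^+ k) = a * b ^+ gap beta k * c ^+ k]; the truncated
   subtraction is exact for [0 < x], see [gapE]. *)
Definition gap (x k : nat) : nat := k * x ^ k - x * geo x k.

Lemma geo_le x k : 0 < x -> x * geo x k <= k * x ^ k.
Proof.
move=> x_gt0; elim: k => [|k IH]; first by rewrite geo0 muln0.
rewrite -addn1 geoD mulnDr addn1 mulSn addnC.
rewrite geoS geo0 muln0 addn0 muln1 -expnS leq_add2l (leq_trans IH) //.
by rewrite expnS mulnCA leq_pmull.
Qed.

Lemma gapE x k : 0 < x -> gap x k + x * geo x k = k * x ^ k.
Proof. by move=> x_gt0; rewrite subnK ?geo_le. Qed.

(** With [x = d.+1], both [k * x ^ k] and [x * geo x k] reduce to [k] modulo [p ^ (e + n)]. *)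
Lemma gap_pfactor p n d e k : prime p -> odd p -> 0 < n ->
  p ^ n %| d -> p ^ e %| k -> p ^ (e + n) %| gap d.+1 k.
Proof.
move=> p_pr p_odd n_gt0 pd pk; have [u Du] := geo_pfactor p_pr p_odd n_gt0 pd pk.
have := gapE k (ltn0Sn d).
rewrite geo_exp Du; case/dvdnP: pd => w ->; case/dvdnP: pk => v ->; rewrite expnD => E.
rewrite -(@dvdn_addl (w * p ^ n * v * p ^ e + (w * p ^ n).+1 * (p ^ e * p ^ n * u))).
  apply/dvdnP; exists (w * v * (v * p ^ e + p ^ e * p ^ n * u)); nia.
by apply/dvdnP; exists (w * v + (w * p ^ n).+1 * u); ring.
Qed.

Lemma double_bin2 k : 2 * 'C(k.+1, 2) = k.+1 * k.
Proof. by rewrite -[2 in LHS]/(2`!) mulnC bin_ffact /falling_factorial /= muln1. Qed.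

Lemma gap_self d : exists z, gap d.+2 d.+2 =
  d.+2 * (d.+1 ^ 2 + d * d.+1 * 'C(d.+2, 2) + d * d.+1 ^ 2 * ('C(d.+2, 3) + d.+1 * z)).
Proof.
have := gapE d.+2 (ltn0Sn d.+1); rewrite geo_exp.
have [z ->] := geo_trunc d.+1 d.+2 => E; exists z.
(* For [x = d.+2] one has [x ^ x - geo x x = 1 + d * geo x x]; the leading term of the lemma is
   [1 + d * d.+2 = d.+1 ^ 2]. *)
have {E}-> : gap d.+2 d.+2 = d.+2 *
    (1 + d * (d.+2 + 'C(d.+2, 2) * d.+1 + 'C(d.+2, 3) * d.+1 ^ 2 + d.+1 ^ 3 * z)).
  by move: (gap _ _) (_ + d.+1 ^ 3 * z) E => G T; nia.
ring.
Qed.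

(** Each term of [gap_self] contains the square of [x - 1], or [x - 1] times ['C(x, 2)], which
    [p ^ m] divides because [p] is odd. *)
Lemma gap_self_pfactor p m d : prime p -> odd p -> p ^ m %| d ->
  p ^ (2 * m) %| gap d.+1 d.+1.
Proof.
case: d => [|d] p_pr p_odd pd; first by rewrite /gap /geo big_ord_recl big_ord0.
have [z ->] := gap_self d; rewrite expnM.
have pd2 : (p ^ 2) ^ m %| d.+1 ^ 2 by rewrite -expnM mulnC expnM dvdn_exp2r.
have pC : p ^ m %| 'C(d.+2, 2).
  by rewrite -(@Gauss_dvdr _ 2) ?coprimeXl ?coprimen2 // double_bin2 dvdn_mull.
have p2m : (p ^ 2) ^ m = p ^ m * p ^ m by rewrite -expnM mulnC expnM -mulnn.
rewrite dvdn_mull // !dvdn_add //; last by rewrite dvdn_mulr // dvdn_mull.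
by rewrite p2m dvdn_mul // dvdn_mull.
Qed.

(** The factor 6 clears the binomial denominators and isolates [d.+1 ^ 2]; the remaining cofactor is
    3 modulo [d.+1]. *)
Lemma gap_self6 d : exists z,
  6 * gap d.+2 d.+2 =
    d.+2 * (d.+1 ^ 2 * (3 + 3 * d.+1 ^ 2 + d ^ 2 * d.+1 * d.+2 + 6 * d * d.+1 * z)).
Proof.
have [z ->] := gap_self d; exists z.
have C3 : 6 * 'C(d.+2, 3) = d.+2 * d.+1 * d.
  by rewrite -[6 in LHS]/(3`!) mulnC bin_ffact /falling_factorial /= muln1 mulnA.
rewrite [LHS](_ : _ = d.+2 * (6 * d.+1 ^ 2 + 3 * d * d.+1 * (2 * 'C(d.+2, 2))
  + d * d.+1 ^ 2 * (6 * 'C(d.+2, 3)) + 6 * d * d.+1 ^ 3 * z)); last by ring.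
by rewrite double_bin2 C3; ring.
Qed.

(** For [p > 3] the cofactor in [gap_self6] is 3 modulo [p], hence prime to [p]. For [p = 3] it is
    divisible by 3, and the quotient is prime to 3 unless the base is 7 modulo 9. *)
Lemma logn_gap_self p d : prime p -> 0 < logn p d ->
  3 < p \/ p = 3 /\ d.+1 %% 9 <> 7 ->
  logn p (gap d.+1 d.+1) = 2 * logn p d.
Proof.
case: d => [|d] p_pr; first by rewrite logn0.
move=> n_gt0 hp; have p_d : p %| d.+1.
  by move: n_gt0; rewrite logn_gt0 mem_primes => /and3P[].
have [z E] := gap_self6 d.
have p_d2 : logn p d.+2 = 0.
  rewrite lognE p_pr /=; case: ifP => // h.
  have := dvdn_sub h p_d; rewrite subSnn dvdn1 => /eqP p1.
  by rewrite p1 in p_pr.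
have {E} [u [v [W [Eg pu pv WW]]]] : exists u v W : nat, [/\ u * gap d.+2 d.+2 =
    v * (d.+1 ^ 2 * W), ~~ (p %| u), logn p v = 0 & 0 < v /\ ~~ (p %| W)].
  case: hp => [p3|[p3 h9]].
    exists 6, d.+2, (3 + 3 * d.+1 ^ 2 + d ^ 2 * d.+1 * d.+2 + 6 * d * d.+1 * z).
    split=> //.
      apply/negP; rewrite (Euclid_dvdM 2 3) // => /orP[] /dvdn_leq; lia.
    split=> //.
    have -> : 3 + 3 * d.+1 ^ 2 + d ^ 2 * d.+1 * d.+2 + 6 * d * d.+1 * z =
        d.+1 * (3 * d.+1 + d ^ 2 * d.+2 + 6 * d * z) + 3 by ring.
    by rewrite dvdn_addr ?dvdn_mulr //; apply/negP => /dvdn_leq; lia.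
  subst p; case/dvdnP: p_d => e De.
  exists 2, d.+2, (1 + 9 * e ^ 2 + d ^ 2 * e * d.+2 + 6 * d * e * z).
  split=> //; first by apply/eqP; rewrite -(eqn_pmul2l (_ : 0 < 3)) //; apply/eqP;
    rewrite mulnA E De; ring.
  split=> //; apply/negP => h3; apply: h9.
  (* Since [d.+1 = 3 * e], the product [d ^ 2 * d.+2] is 1 modulo 3, so the cofactor is [1 + e]
     modulo 3. Below, [e] is replaced by [e.+1], and [k] is the quotient in
     [d ^ 2 * d.+2 = 1 + 3 * k]. *)
  have : 3 %| 1 + e.
    case: e => [|e] in De h3 *; first by [].
    have Dd : d = 3 * e + 2 by lia.
    pose k := 3 * (3 * e ^ 2 + 4 * e + 1) * e.+1 + (3 * e ^ 2 + 4 * e + 1) + e.+1.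
    rewrite -(@dvdn_addl (3 * (3 * e.+1 ^ 2 + e.+1 * k + 2 * d * e.+1 * z))) ?dvdn_mulr //.
    apply: etrans h3; congr (3 %| _); rewrite /k Dd; ring.
  lia.
have W0 : 0 < W by case: WW => _; case: W {Eg} => //; rewrite dvdn0.
have u0 : 0 < u by case: u pu {Eg} => //; rewrite dvdn0.
have v0 : 0 < v by case: WW.
have g0 : 0 < gap d.+2 d.+2.
  by case: (gap _ _) Eg => // /esym/eqP; rewrite muln0 !muln_eq0; lia.
have := congr1 (logn p) Eg.
rewrite lognM // lognM ?muln_gt0 ?expn_gt0 ?W0 //.
rewrite lognM ?expn_gt0 ?W0 // lognX pv.
case: WW => _ pW; rewrite !(@lognE p u) !(@lognE p W) (negPf pu) (negPf pW) !andbF.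
lia.
Qed.

(** * Consequences of the relations *)

Local Open Scope group_scope.

(** Natural exponents suffice: in a finite group the integers of [Grels] matter only modulo the
    orders of the generators. *)
Definition rels (gT : finGroupType) (x y : gT) (i j : nat) : Prop :=
  x ^ [~ x, y] = x ^+ i /\ y ^ [~ y, x] = y ^+ j.

Lemma relsC (gT : finGroupType) (x y : gT) i j : rels x y i j -> rels y x j i.
Proof. by case. Qed.

Lemma conjg_expn (gT : finGroupType) (x c : gT) i k :
  x ^ c = x ^+ i -> x ^ (c ^+ k) = x ^+ (i ^ k)%N.
Proof.
move=> xc; elim: k => [|k IH]; first by rewrite expg0 conjg1.
by rewrite expgSr conjgM IH conjXg xc -expgM expnS.
Qed.

Lemma expg_comm_conj (gT : finGroupType) (x c : gT) i j k :
  x ^ c = x ^+ i -> x ^+ j * c ^+ k = c ^+ k * x ^+ (j * i ^ k)%N.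
Proof. by move=> xc; rewrite conjgC conjXg (conjg_expn _ xc) -expgM mulnC. Qed.

Lemma expg_mul_geo (gT : finGroupType) (x c : gT) i k :
  x ^ c = x ^+ i -> (x * c) ^+ k = c ^+ k * x ^+ (i * geo i k)%N.
Proof.
move=> xc; elim: k => [|k IH]; first by rewrite geo0 muln0 !expg0 mulg1.
rewrite expgSr IH -mulgA [_ * (x * c)]mulgA -expgSr.
have := expg_comm_conj (i * geo i k).+1 1 xc; rewrite expg1 => ->.
by rewrite mulgA -expgSr geoS; congr (_ * _ ^+ _); ring.
Qed.

Section Relators.
Variables (gT : finGroupType) (a b : gT) (i j : nat).
Hypothesis ab : rels a b i j.
Let c := [~ a, b].

Lemma conj_expg_geo k : (a ^+ k) ^ b = c ^+ k * a ^+ (i * geo i k)%N.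
Proof. by case: ab => ac _; rewrite conjXg conjg_mulR (expg_mul_geo _ ac). Qed.

(** Write [[~ a, b ^+ k]] as the conjugate of [b ^- k] by [a], times [b ^+ k], and expand with [b ^
    a = b * [~ b, a]]. *)
Lemma conj_expg_gap k : 0 < j -> a ^ (b ^+ k) = a * b ^+ gap j k * c ^+ k.
Proof.
case: (ab) => _ bc j0.
have E := expg_comm_conj k k bc.
have cE : c = [~ b, a]^-1 by rewrite invg_comm.
rewrite conjg_mulR -mulgA; congr (a * _).
rewrite commgEr conjVg [_ ^ a]conjXg conjg_mulR (expg_mul_geo _ bc) invMg -mulgA.
rewrite cE expgVn; apply: (mulgI (b ^+ (j * geo j k)%N)).
rewrite mulKVg mulgA -expgD addnC gapE //.
by apply: (mulgI ([~ b, a] ^+ k)); rewrite mulKVg mulgA -E mulgK.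
Qed.

Lemma conj_comm_expn k : a ^ (c ^+ k) = a ^+ (i ^ k)%N.
Proof. by case: ab => ac _; apply: conjg_expn. Qed.

Lemma conj_comm_expnV k : b = (b ^ (c ^+ k)) ^+ (j ^ k)%N.
Proof.
case: ab => _ bc; rewrite -conjXg -(conjg_expn k bc) -conjgM.
by rewrite -invg_comm expgVn mulVg conjg1.
Qed.

(** The element [a ^+ (i ^ e) = a ^ (c ^+ e)] is conjugated by [b] in two ways: as a power of [a],
    and after moving [b] past [c ^+ e], which turns it into [b ^+ (j ^ e)]. *)
Lemma rel_gap e : 0 < i -> 0 < j ->
  c ^+ (i ^ e)%N * a ^- gap i (i ^ e) * c ^- (j ^ e)%N
    = (b ^ (c ^+ e)) ^+ gap j (j ^ e).
Proof.
move=> i0 j0; set ga := (i ^ e)%N; set de := (j ^ e)%N.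
have Ea : a ^+ ga = a ^ (c ^+ e) by rewrite conj_comm_expn.
have Eb : c ^+ e * b = b ^+ de * c ^+ e.
  by rewrite [RHS]conjgC conjXg -conj_comm_expnV.
have := conj_expg_geo ga; rewrite {1}Ea -conjgM Eb conjgM.
rewrite conj_expg_gap // !conjMg -Ea !conjXg.
rewrite [c ^ _](_ : _ = c); last by rewrite conjgE -expgS expgSr mulKg.
set u := _ ^+ gap j de; move=> E.
have {E} -> : u = a ^- ga * (c ^+ ga * a ^+ (i * geo i ga)) * c ^- de.
  by rewrite -E -[_ * _ * c ^+ de]mulgA mulKg mulgK.
congr (_ * _); case: ab => ac _.
apply: (mulgI (a ^+ ga)); rewrite mulKVg mulgA (expg_comm_conj _ _ ac) -mulgA.
by rewrite -gapE // [(gap _ _ + _)%N]addnC expgD mulgK.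
Qed.

Lemma commute_conj_comm k : commute b (b ^ (c ^+ k)).
Proof. by rewrite {1}(conj_comm_expnV k); apply/commute_sym/commuteX. Qed.

(* Comparing [rel_gap] with its conjugate by [c] puts a power of [a] in the
   cyclic group generated by a conjugate of [b]. *)
Lemma commute_expg_gap e : 0 < i -> 0 < j ->
  commute (a ^+ (i.-1 * gap i (i ^ e))%N) b.
Proof.
move=> i0 j0; have := rel_gap e i0 j0; set g := gap i _; set f := gap j _.
set ga := (i ^ e)%N; set de := (j ^ e)%N; set u := _ * _ => E.
have ac : a ^ c = a ^+ i by case: ab.
have Eu : u = (u ^ c) ^+ j.
  have bj : (b ^ c) ^+ j = b by rewrite {2}(conj_comm_expnV 1) expg1 expn1.
  by rewrite E conjXg -conjgM -expgSr expgS conjgM expgAC -[in RHS]conjXg bj.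
(* In [(u ^ c)^-1 * u] the outer powers of [c] cancel, leaving exactly this conjugate. *)
pose z := (a ^+ (i.-1 * g)%N) ^ (c ^- de).
have Ez : z = (u ^ c)^-1 * u.
  have cX k : (c ^+ k) ^ c = c ^+ k by rewrite conjgE -expgSr expgS mulKg.
  rewrite /u !conjMg !conjVg !cX conjXg ac.
  rewrite !invMg !invgK /z conjgE invgK -!mulgA mulKg !mulgA; congr (_ * _).
  rewrite -!mulgA; congr (_ * _); apply: (mulIg (a ^+ g)).
  rewrite mulgKV -expgM -expgD; congr (_ ^+ _); nia.
(* Both [u] and [u ^ c] are powers of [b ^ (c ^+ e.+1)], which commutes with [b]. *)
have zb : commute z b.
  rewrite Ez {2}Eu; apply/commute_sym/commuteM.
    apply/commuteV; rewrite E conjXg -conjgM -expgSr.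
    exact/commuteX/commute_conj_comm.
  rewrite E conjXg -conjgM -expgSr.
  exact/commuteX/commuteX/commute_conj_comm.
have za : commute z a.
  have -> : a = (a ^ (c ^- de)) ^+ (i ^ de)%N.
    by rewrite -conjXg -conj_comm_expn -conjgM mulgV conjg1.
  by rewrite /z conjXg; apply/commuteX/commute_sym/commuteX.
have zc : commute z c.
  by rewrite /c commgEl conjgE; do !apply: commuteM => //; apply: commuteV.
(* Commuting with [a] and [b], [z] commutes with [c], so undoing the conjugation by [c ^- de] does
   not change it. *)
suff -> : a ^+ (i.-1 * g)%N = z by [].
have /commgP/conjg_fixP zde : commute z (c ^+ de) by apply: commuteX.
by rewrite -[in RHS]zde /z -conjgM mulVg conjg1.
Qed.

(** The central power [z] of [a] from [commute_expg_gap] is fixed by [c], while [c] raises it to the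
    power [i]; so [z ^+ i.-1 = 1]. *)
Lemma expg_gap_eq1 e : 0 < i -> 0 < j -> a ^+ (i.-1 ^ 2 * gap i (i ^ e))%N = 1.
Proof.
move=> i0 j0; have := commute_expg_gap e i0 j0; set z := a ^+ _ => zb.
have za : commute z a by apply/commute_sym/commuteX.
have zc : commute z c.
  by rewrite /c commgEl conjgE; do !apply: commuteM => //; apply: commuteV.
have/commgP/conjg_fixP := zc; rewrite {1}/z conjXg; case: ab => -> _.
rewrite -expgM => E; apply: (mulgI z); rewrite mulg1 -{2}E -expgD.
by congr (_ ^+ _); nia.
Qed.

End Relators.

(** * Nilpotency *)

Lemma totient_lt r : 1 < r -> 0 < totient r < r.
Proof.
move=> r1; rewrite totient_gt0 ltnW //= totient_count_coprime.
case: r r1 => // r r1; rewrite big_mkord big_ord_recl /= /coprime gcdn0.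
have -> : (r.+1 == 1%N) = false by lia.
rewrite add0n ltnS -[leqRHS]card_ord -sum1_card leq_sum // => k _.
by case: (_ == _).
Qed.

Section Nilpotent.
Variables (gT : finGroupType) (a b : gT) (i j : nat).
Hypotheses (ab : rels a b i j) (i0 : 0 < i) (j0 : 0 < j).
Let c := [~ a, b].

(** The power [a ^+ i] is a conjugate of [a], hence has the same order. *)
Lemma coprime_order_rels : coprime #[a] i.
Proof.
have := orderXgcd a i; case: ab => <- _; rewrite orderJ => E.
rewrite /coprime; have := order_gt0 a; rewrite {1}E => h.
have := divnK (dvdn_gcdl #[a] i); rewrite -E.
have := gcdn_gt0 #[a] i; have := order_gt0 a; nia.
Qed.

(** Conjugating [a ^+ #[a] = 1] by [b] shows that [c ^+ #[a]] is a power of [a], so it centralizes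
    [a]. *)
Lemma exp_order_rels : i ^ #[a] = 1 %[mod #[a]].
Proof.
apply/eqP; rewrite -eq_expg_mod_order expg1; apply/eqP.
have := conj_expg_geo ab #[a]; rewrite expg_order conj1g -/c => E.
have {}E : c ^+ #[a] = a ^- (i * geo i #[a]).
  by apply: (mulIg (a ^+ (i * geo i #[a])%N)); rewrite mulVg.
rewrite -(conj_comm_expn ab) -/c E; apply/conjg_fixP/commgP.
exact/commuteV/commuteX.
Qed.

(* With [r] the order of [i] modulo [q] and [e = totient r], the exponent
   [i ^ e] is congruent to 1 modulo [r] but not modulo [q]. *)
Lemma prime_order_rels q : prime q -> q %| #[a] -> q %| i.-1.
Proof.
move=> q_pr qa; have q1 := prime_gt1 q_pr.
have coqi : coprime q i := coprime_dvdl qa coprime_order_rels.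
have ex_r : exists r, (0 < r) && (i ^ r == 1 %[mod q]).
  exists (totient q); rewrite totient_gt0 ltnW //=; apply/eqP.
  by apply: Euler_exp_totient; rewrite coprime_sym.
pose r := ex_minn ex_r.
have [r0 ir min_r] : [/\ 0 < r, i ^ r = 1 %[mod q]
    & forall k, 0 < k -> i ^ k = 1 %[mod q] -> r <= k].
  rewrite /r; case: ex_minnP => s /andP[s0 /eqP is1] smin; split=> // k k0 ik.
  by apply: smin; rewrite k0; apply/eqP.
have ir_dvd w : i ^ (r * w) = 1 %[mod q] by rewrite expnM -modnXm ir modnXm exp1n.
have r_dvd k : i ^ k = 1 %[mod q] -> r %| k.
  move=> ik; rewrite /dvdn; apply/negPn/negP; rewrite -lt0n => k0.
  suff /(min_r _ k0) : i ^ (k %% r) = 1 %[mod q] by rewrite leqNgt ltn_pmod.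
  by rewrite -ik [in RHS](divn_eq k r) mulnC expnD -[RHS]modnMml ir_dvd modnMml mul1n.
case: (leqP r 1) => [r1|r1].
  have {r1} r1 : r = 1%N by lia.
  move: ir; rewrite r1 expn1 => /eqP.
  by rewrite eqn_mod_dvd // subn1.
(* This makes [i] prime to [r], so that Euler's theorem applies modulo [r]. *)
have ra : r %| #[a].
  apply: r_dvd; case/dvdnP: (qa) => w Dw.
  have := exp_order_rels; rewrite {2 3}Dw => E.
  by have := congr1 (modn^~ q) E; rewrite /= !modn_dvdm ?dvdn_mull.
have cori : coprime i r.
  by rewrite coprime_sym (coprime_dvdl ra coprime_order_rels).
have /andP[e0 er] := totient_lt r1; set e := totient r in e0 er.
have ie : i ^ e = 1 %[mod r] by apply: Euler_exp_totient.
(* So [q] divides [i.-1] or [gap i (i ^ e)]; only the second case remains. *)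
have := expg_gap_eq1 ab e i0 j0 => /eqP; rewrite -order_dvdn.
move=> /(dvdn_trans qa); rewrite Euclid_dvdM // Euclid_dvdX //=.
rewrite andbT => /orP[//|qg].
have [w Dw] : exists w, (i ^ e = 1 + r * w)%N.
  have : (r %| i ^ e - 1)%N by rewrite -eqn_mod_dvd ?expn_gt0 ?i0 //; apply/eqP.
  case/dvdnP => w E; exists w; rewrite mulnC -E subnKC // expn_gt0 i0 //.
have iie : i ^ (i ^ e) = i %[mod q].
  by rewrite Dw expnD expn1 -modnMmr ir_dvd modnMmr muln1.
have := gapE (i ^ e) i0; move: qg; set g := gap _ _; set T := geo i _ => qg E.
have DT : (i ^ (i ^ e) = 1 + i.-1 * T)%N by rewrite -{1}(prednK i0) geo_exp prednK.
apply/negPn/negP => qd.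
have coqd : coprime q i.-1 by rewrite prime_coprime.
(* It remains to see [i ^ e = 1] modulo [q]. From [i.-1 * T = i ^ (i ^ e) - 1], which is [i.-1]
   modulo [q], one gets [T = 1]; then [gapE] reads [i = i ^ e * i] modulo [q]. *)
suff : r <= e by rewrite leqNgt er.
apply: min_r => //.
have T0 : 0 < T by rewrite /T; case: (i ^ e)%N (expn_gt0 i e) => [|n _]; rewrite ?i0 // geoS.
have [t Dt] : exists t, (T = 1 + q * t)%N.
  have : (q %| T - 1)%N.
    rewrite -(Gauss_dvdr _ coqd) mulnBr -eqn_mod_dvd ?leq_mul //.
    by rewrite -(eqn_modDl 1) -DT muln1 add1n prednK // iie.
  by case/dvdnP=> t E'; exists t; rewrite mulnC -E' subnKC.
case/dvdnP: qg => g' Dg; apply/eqP; rewrite eqn_mod_dvd ?expn_gt0 ?i0 //.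
rewrite -(Gauss_dvdr _ coqi) -(@dvdn_addl (i ^ e * i.-1 * q * t)%N); last first.
  by rewrite dvdn_mulr // dvdn_mull.
apply/dvdnP; exists (g' + i * t)%N.
move: E; rewrite DT Dg Dt; move: (expn_gt0 i e); rewrite i0 /=.
case: (i ^ e)%N => // y _ E; rewrite subn1 /=.
case: (i) i0 E => // x _ /= E; clear -E; lia.
Qed.

(** With [k = #[c] %/ q], every prime [r] dividing [#[a]] divides [i.-1], so the valuation of
    [i ^ k - 1] at [r] is at least [logn r k + 1], hence at least that of [#[c]] and of [#[a]]. *)
Lemma commute_comm_pdiv q : prime q -> q %| #[c] -> #[a] %| #[c] ->
  commute a (c ^+ (#[c] %/ q)).
Proof.
move=> q_pr qc a_c; apply/commgP/conjg_fixP; rewrite (conj_comm_expn ab).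
rewrite -[RHS]expg1; apply/eqP; rewrite eq_expg_mod_order eqn_mod_dvd ?expn_gt0 ?i0 //.
apply/(dvdn_partP _ (order_gt0 a)) => r; rewrite mem_primes => /and3P[r_pr _ ra].
rewrite p_part; set k := (_ %/ q)%N.
have k0 : 0 < k by rewrite divn_gt0 ?prime_gt0 // dvdn_leq.
have [u] := exp_pfactor r_pr (prime_order_rels r_pr ra) (pfactor_dvdnn r k).
rewrite prednK // => ->; rewrite addKn dvdn_mulr // dvdn_exp2l //.
apply: leq_trans (dvdn_leq_log r (order_gt0 c) a_c) _.
have Dc : #[c] = (k * q)%N by rewrite divnK.
rewrite [X in logn r X]Dc (lognM _ k0 (prime_gt0 q_pr)).
by rewrite (logn_prime r q_pr) addnC; case: eqP.
Qed.

(** Choose [k] a multiple of [#[c]] such that [a ^+ k] has prime order [q]. As [c ^+ k = 1],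
    conjugation by [b] gives [a ^+ (i * geo i k)], which is shown to equal [a ^+ k]. *)
Lemma expg_central_rels : ~~ (#[a] %| #[c]) ->
  exists2 k, a ^+ k != 1 & commute (a ^+ k) b.
Proof.
rewrite order_dvdn -order_eq1 => r1; set r := #[_] in r1.
have q_pr : prime (pdiv r).
  by apply: pdiv_prime; have := order_gt0 (a ^+ #[c]); rewrite -/r; lia.
set q := pdiv r in q_pr; have qr : q %| r := pdiv_dvd r.
have r0 : 0 < r := order_gt0 _.
have rq0 : 0 < r %/ q by rewrite divn_gt0 ?pdiv_gt0 // dvdn_leq.
pose k := (#[c] * (r %/ q))%N.
have Ez : #[a ^+ k] = q.
  by rewrite /k expgM orderXdiv ?dvdn_div // -/r -{1}(divnK qr) mulKn.
exists k.
  by rewrite -order_eq1 Ez; case: eqP q_pr => // ->.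
have qa : q %| #[a] by rewrite -Ez orderXdvd.
have qd := prime_order_rels q_pr qa.
have k0 : 0 < k by rewrite muln_gt0 order_gt0.
apply/commgP/conjg_fixP.
have Es := conj_expg_geo ab k.
have ck1 : c ^+ k = 1 by rewrite /k expgM expg_order expg1n.
rewrite -/c ck1 mul1g in Es; rewrite Es.
have Oz : #[a ^+ (i * geo i k)] = q by rewrite -Es orderJ.
have Dk : #[a] %| q * k by rewrite mulnC order_dvdn expgM -[X in _ ^+ X]Ez expg_order.
have := expg_order (a ^+ (i * geo i k)); rewrite Oz -expgM => /eqP.
rewrite -order_dvdn => Ds.
case: (eqVneq q 2) => [q2|qn2].
  (* For [q = 2] the cyclic group [<[a]>] has only one involution. *)
  have half s : #[a ^+ s] = q -> a ^+ s = a ^+ (#[a] %/ 2).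
    move=> Os; have s_odd : ~~ (#[a] %| s).
      by rewrite order_dvdn -order_eq1 Os q2.
    have : #[a] %| s * 2 by rewrite order_dvdn expgM -q2 -[X in _ ^+ X]Os expg_order.
    case/dvdnP => x Dx; have x_odd : odd x.
      apply: contraR s_odd => x_even; apply/dvdnP; exists x./2.
      by move: Dx (even_halfK x_even); clear; lia.
    have Da : #[a] = (#[a] %/ 2 * 2)%N.
      rewrite divnK //; apply/negPn; rewrite dvdn2; apply/negP => oa.
      by have := congr1 odd Dx; rewrite !oddM x_odd (negPn oa) andbF.
    have -> : s = (#[a] %/ 2 + #[a] * x./2)%N.
      move: Dx (odd_double_half x); rewrite x_odd Da => Dx Ex.
      rewrite mulnK //; apply/eqP; rewrite -(eqn_pmul2r (_ : 0 < 2)) //; apply/eqP.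
      rewrite Dx -{1}Ex -muln2 /=; ring.
    by rewrite expgD expgM expg_order expg1n mulg1.
  by rewrite (half k Ez) (half _ Oz).
have q_odd : odd q by case: (even_prime q_pr) qn2 => [->|].
set e := logn q k; have qk : q ^ e %| k by apply: pfactor_dvdnn.
have qd1 : q ^ 1 %| i.-1 by rewrite expn1.
have [u] := geo_pfactor q_pr q_odd (ltn0Sn 0) qd1 qk; rewrite prednK // => Eg.
have [v Dv] := dvdnP qd.
have Dig : (i * geo i k = k + q ^ e.+1 * (u + v * (k %/ q ^ e + q * u)))%N.
  rewrite Eg -{1}(prednK i0) Dv; have := divnK qk; rewrite addn1 expnS.
  by move: (k) (q ^ e)%N (k %/ q ^ e)%N => k1 y x <-; ring.
rewrite Dig expgD (_ : a ^+ (q ^ e.+1 * _) = 1) ?mulg1 //.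
move: (u + _)%N Dig => w Dig; apply/eqP; rewrite -order_dvdn.
(* Writing [k = k' * q ^ e] with [k'] prime to [q], this gcd is [q ^ e.+1 * gcdn k' w], which
   divides [q ^ e.+1 * w]. *)
have : #[a] %| gcdn (q * k) (q * (q ^ e.+1 * w)).
  rewrite dvdn_gcd Dk -(@dvdn_addr (q * k)) // -mulnDr -Dig mulnC //.
rewrite -muln_gcdr; have [k' co Dk'] := pfactor_coprime q_pr k0.
rewrite {1}Dk' -/e expnS [(k' * _)%N]mulnC [(q * _)%N in X in gcdn _ X]mulnC -mulnA.
rewrite -muln_gcdr Gauss_gcdr 1?coprime_sym // mulnA => /dvdn_trans; apply.
by rewrite dvdn_mul // dvdn_gcdr.
Qed.
End Nilpotent.

(** If the order of a generator does not divide that of [[~ a, b]], some power of that generator is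
    central. Otherwise the commutator is nontrivial and its powers of prime order commute with both
    generators. *)
Lemma center_rels_neq1 (gT : finGroupType) (a b : gT) i j :
  rels a b i j -> 0 < i -> 0 < j -> <<[set a; b]>> != 1 ->
  'Z(<<[set a; b]>>) != 1.
Proof.
move=> ab i0 j0 ab1; set G := <<_>> in ab1 *.
have aG : a \in G by rewrite mem_gen // !inE eqxx.
have bG : b \in G by rewrite mem_gen // !inE eqxx orbT.
have cenP z : z \in G -> z != 1 -> commute z a -> commute z b -> 'Z(G) != 1.
  move=> zG z1 za zb; apply/trivgPn; exists z => //.
  rewrite inE zG cent_gen; apply/centP => x; rewrite !inE.
  by case/orP => /eqP->.
case: (boolP (#[a] %| #[[~ a, b]])) => [a_c|]; last first.
  case/(expg_central_rels ab i0 j0) => k z1 zb.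
  by apply: (cenP (a ^+ k)); rewrite ?groupX //; apply/commute_sym/commuteX.
case: (boolP (#[b] %| #[[~ b, a]])) => [b_c|]; last first.
  case/(expg_central_rels (relsC ab) j0 i0) => k z1 za.
  by apply: (cenP (b ^+ k)); rewrite ?groupX //; apply/commute_sym/commuteX.
have c1 : 1 < #[[~ a, b]].
  rewrite ltn_neqAle order_gt0 andbT eq_sym; apply: contraNneq ab1 => c1.
  move: a_c b_c; rewrite -(invg_comm a b) orderV c1 !dvdn1 !order_eq1 /G => /eqP-> /eqP->.
  by rewrite setUid -[<<_>>]/(cycle 1) cycle1.
have q_pr := pdiv_prime c1; have qc := pdiv_dvd #[[~ a, b]].
set q := pdiv _ in q_pr qc.
have cG : [~ a, b] \in G by rewrite groupR.
apply: (cenP ([~ a, b] ^+ (#[[~ a, b]] %/ q))).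
- by rewrite groupX.
- set k := (_ %/ q)%N; have Dc : #[[~ a, b]] = (k * q)%N by rewrite divnK.
  have k0 : 0 < k by rewrite divn_gt0 ?prime_gt0 // dvdn_leq.
  rewrite -order_eq1 orderXdiv ?dvdn_div // [X in X %/ _]Dc mulKn //.
  by case: eqP q_pr => // ->.
- exact/commute_sym/(commute_comm_pdiv ab).
have := commute_comm_pdiv (relsC ab) j0 i0 q_pr.
move: b_c; rewrite -(invg_comm a b) orderV => b_c /(_ qc b_c); rewrite expgVn => h.
by apply/commute_sym; rewrite -[X in commute _ X]invgK; apply: commuteV.
Qed.

Lemma quotient_gen2 (gT : finGroupType) (H : {group gT}) (a b : gT) :
  a \in 'N(H) -> b \in 'N(H) ->
  <<[set a; b]>> / H = <<[set coset H a; coset H b]>>.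
Proof.
move=> Na Nb; rewrite quotient_gen; last by apply/subsetP => x; case/set2P=> ->.
by rewrite /quotient morphimU !morphim_set1.
Qed.

(** Induction on the order: the quotient by the centre satisfies the same relations and is
    smaller. *)
Lemma nilpotent_rels (gT : finGroupType) (a b : gT) i j :
  rels a b i j -> 0 < i -> 0 < j -> nilpotent <<[set a; b]>>.
Proof.
move=> ab i0 j0; have [n] := ubnP #|<<[set a; b]>>|.
elim: n gT a b ab => // n IH gT a b ab leGn.
set G := <<[set a; b]>> in leGn *.
have [->|G1] := eqVneq G 1; first exact: nilpotent1.
have Z1 := center_rels_neq1 ab i0 j0 G1.
rewrite -quotient_center_nil.
have nZ : [set a; b] \subset 'N('Z(G)).
  by apply: subset_trans (subset_gen _) (gFnorm _ _).
have Na : a \in 'N('Z(G)) by apply: (subsetP nZ); rewrite !inE eqxx.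
have Nb : b \in 'N('Z(G)) by apply: (subsetP nZ); rewrite !inE eqxx orbT.
rewrite quotient_gen2 //; apply: IH.
  by case: ab => h1 h2; split; rewrite -morphR // -morphJ ?groupR // ?h1 ?h2 morphX.
rewrite ltnS in leGn; rewrite -quotient_gen2 // (leq_trans _ leGn) //.
by rewrite ltn_quotient // center_sub.
Qed.

(** * Orders of the generators in a p-group *)

Lemma logn_eq0 p k : ~~ (p %| k) -> logn p k = 0%N.
Proof. by move=> pk; rewrite lognE (negPf pk) !andbF. Qed.

Lemma logn_addl p s x : prime p -> 0 < s -> p ^ (logn p s).+1 %| x ->
  logn p (s + x) = logn p s.
Proof.
move=> p_pr s0 /dvdnP[w ->]; have [s1 co {1}->] := pfactor_coprime p_pr s0.
rewrite expnS (_ : (_ + _ = (s1 + p * w) * p ^ logn p s)%N); last by ring.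
have h : ~~ (p %| s1 + p * w) by rewrite dvdn_addl ?dvdn_mulr // -prime_coprime //.
have h0 : 0 < s1 + p * w by case: (s1 + _)%N h; rewrite ?dvdn0.
have p0 : 0 < p ^ logn p s by rewrite expn_gt0 prime_gt0.
by rewrite (lognM _ h0 p0) (logn_eq0 h) pfactorK.
Qed.

Lemma logn_geo p d k : prime p -> odd p -> p %| d -> 0 < k ->
  logn p (geo d.+1 k) = logn p k.
Proof.
move=> p_pr p_odd pd k0.
have pd1 : p ^ 1 %| d by rewrite expn1.
have [u ->] := geo_pfactor p_pr p_odd (ltn0Sn 0) pd1 (pfactor_dvdnn p k).
by rewrite logn_addl // addn1 dvdn_mulr.
Qed.

Lemma p_elt_expg_eq1 (gT : finGroupType) (x : gT) (p k : nat) : p.-elt x -> 0 < k ->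
  x ^+ k = 1 -> x ^+ (p ^ logn p k)%N = 1.
Proof.
move=> px k0 /eqP; rewrite -order_dvdn => xk; apply/eqP; rewrite -order_dvdn.
by rewrite -p_part -(part_pnat_id px) partn_dvd.
Qed.

Lemma expg_eq1_dvd (gT : finGroupType) (x : gT) k l :
  x ^+ k = 1 -> k %| l -> x ^+ l = 1.
Proof. by move=> xk /dvdnP[w ->]; rewrite mulnC expgM xk expg1n. Qed.

(** For a [p]-element, [x ^+ k] generates the same cyclic group as [x ^+ (p ^ logn p k)]. *)
Lemma p_elt_expg_cycle (gT : finGroupType) (x : gT) (p k l : nat) : prime p -> p.-elt x ->
  0 < k -> p ^ logn p k %| l -> exists w, x ^+ l = x ^+ (k * w)%N.
Proof.
move=> p_pr px k0 /dvdnP[v ->]; have [k1 co Dk] := pfactor_coprime p_pr k0.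
set z := x ^+ (p ^ logn p k)%N.
have : z \in <[z ^+ k1]>.
  have : generator <[z]> (z ^+ k1).
    rewrite generator_coprime; have : p.-elt z by apply: mem_p_elt (mem_cycle _ _).
    by move=> pz; rewrite (pnat_coprime pz) // p'natE -?prime_coprime.
  by rewrite /generator => /eqP <-; apply: cycle_id.
case/cycleP => w Dz; exists (w * v)%N.
rewrite mulnC expgM -/z {1}Dz /z -!expgM [in RHS]Dk.
by congr (_ ^+ _); ring.
Qed.

Section Orders.
Variables (gT : finGroupType) (a b : gT) (i j p : nat).
Hypotheses (ab : rels a b i j) (p_pr : prime p) (p_odd : odd p).
Let c := [~ a, b].
Hypotheses (pa : p.-elt a) (pb : p.-elt b) (pc : p.-elt c).
Let m := logn p i.-1.
Let n := logn p j.-1.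
Hypotheses (n0 : 0 < n) (nm : n <= m) (ji : j < i) (ij : logn p (i - j) = n).
Hypothesis gapj : logn p (gap j j) = (2 * n)%N.

Let p_i : p %| i.-1.
Proof. by have := leq_trans n0 nm; rewrite logn_gt0 mem_primes => /and3P[]. Qed.
Let p_j : p %| j.-1.
Proof. by have := n0; rewrite logn_gt0 mem_primes => /and3P[]. Qed.
Let j1 : 0 < j.-1.
Proof. by have := n0; rewrite logn_gt0 mem_primes => /and3P[]. Qed.
Let i1 : 0 < i.-1.
Proof. by have := leq_trans n0 nm; rewrite logn_gt0 mem_primes => /and3P[]. Qed.
Let i0 : 0 < i. Proof. by case: (i) i1. Qed.
Let j0 : 0 < j. Proof. by case: (j) j1. Qed.
Let s := (i - j)%N.
Let s0 : 0 < s. Proof. by rewrite subn_gt0. Qed.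
Let gapj0 : 0 < gap j j.
Proof. by case: (gap j j) gapj => //; rewrite logn0; lia. Qed.

(** This is [rel_gap] at [e = 1] with the powers of [c] gathered on the left, so that [a ^- gap i i]
    is conjugated by [c ^- j]. *)
Lemma comm_pow_relation : exists x y,
  [/\ c ^+ s * a ^+ x = b ^+ y, p ^ (2 * m) %| x, 0 < y & logn p y = (2 * n)%N].
Proof.
have := rel_gap ab 1 i0 j0; rewrite !expn1 expg1 -/c => R.
pose u := (#[c] * j - j)%N.
have Du : c ^+ u = c ^- j.
  apply: (mulIg (c ^+ j)); rewrite mulVg -expgD subnK ?leq_pmull //.
  by rewrite expgM expg_order expg1n.
(* The factor [#[a].-1] encodes an inverse, [u] stands for [- j] modulo [#[c]], and [b ^ c = b ^+ (j
   ^ #[c].-1)] because [c] is the power [#[c].-1] of its inverse. *)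
exists (#[a].-1 * (gap i i * i ^ u))%N, (j ^ #[c].-1 * gap j j)%N; split.
- have -> : b ^+ (j ^ #[c].-1 * gap j j)%N = (b ^ c) ^+ gap j j.
    rewrite expgM; congr (_ ^+ _); case: ab => _ bc.
    rewrite -(conjg_expn #[c].-1 bc) -invg_comm -/c; congr (b ^ _).
    by rewrite expgVn -invg_expg invgK.
  have -> : a ^+ (#[a].-1 * (gap i i * i ^ u))%N = (a ^- gap i i) ^ (c ^+ u).
    rewrite conjVg conjXg (conj_comm_expn ab) -!expgM [LHS]expgM -invg_expg expgVn.
    by congr (_ ^+ _)^-1; rewrite mulnC.
  rewrite -R -Du /s expgnFr 1?ltnW // -Du -!mulgA; congr (_ * _).
  by rewrite conjgE mulKVg.
- rewrite dvdn_mull // dvdn_mulr //; have := pfactor_dvdnn p i.-1.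
  by move/(gap_self_pfactor p_pr p_odd); rewrite prednK.
- by rewrite muln_gt0 expn_gt0 j0.
rewrite lognM ?expn_gt0 ?j0 // gapj lognX logn_eq0 ?muln0 //.
rewrite -(prednK j0) -addn1 dvdn_addr // dvdn1; by apply: contraTN p_pr => /eqP->.
Qed.

Lemma logn_pred_exp d k : p %| d -> 0 < d -> 0 < k ->
  logn p (d.+1 ^ k - 1) = (logn p d + logn p k)%N.
Proof.
move=> pd d0 k0; rewrite geo_exp addKn lognM ?logn_geo //.
by case: (k) k0 => // k' _; rewrite geoS.
Qed.

Lemma expg_gen_orders :
  [/\ a ^+ (p ^ (m + n))%N = 1, b ^+ (p ^ (2 * n))%N = 1 & c ^+ (p ^ n)%N = 1].
Proof.
have [x [y [R px y0 yn]]] := comm_pow_relation.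
have [ac bc] : a ^ c = a ^+ i /\ b ^ c^-1 = b ^+ j by rewrite /c invg_comm; case: ab.
have b4 : b ^+ (p ^ (4 * n))%N = 1.
  have := expg_gap_eq1 (relsC ab) 1 j0 i0; rewrite expn1.
  move/(p_elt_expg_eq1 pb); rewrite muln_gt0 expn_gt0 j1 gapj0 => /(_ isT).
  rewrite lognM ?expn_gt0 ?j1 // lognX gapj -/n (_ : 2 * n + 2 * n = 4 * n)%N //.
  by ring.
pose t := (i ^ s - 1)%N.
have Dt : (i ^ s = t.+1)%N by rewrite /t subn1 prednK // expn_gt0 i0.
have tn : logn p t = (m + n)%N.
  by rewrite /t -(prednK i0) logn_pred_exp // ij.
have t0 : 0 < t.
  by case: (t) tn => // /eqP; rewrite logn0 eq_sym addn_eq0 [n == _]eqn0Ngt n0 andbF.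
have Eb1 : b = (b ^ c) ^+ j by have := conj_comm_expnV ab 1; rewrite expg1 expn1.
(* A first, weaker bound on [a]: conjugating [a] by [b ^+ y = c ^+ s * a ^+ x] gives [E], and
   comparing [E] with its conjugate by [c] kills [a ^+ (i.-1 * t)]. *)
have a21 : a ^+ (p ^ (2 * m + n))%N = 1.
  have E : b ^+ gap j y * c ^+ y = a ^+ t.
    have := conj_expg_gap ab y j0; rewrite -R conjgM (conj_comm_expn ab) Dt.
    rewrite conjXg [a ^ _](_ : _ = a); last first.
      by apply/conjg_fixP/commgP/commuteX.
    by rewrite expgS -mulgA => /mulgI.
  have b1 : (b ^ c) ^+ (j.-1 * gap j y)%N = 1.
    rewrite -conjXg (expg_eq1_dvd b4) ?conj1g //.
    have -> : (p ^ (4 * n) = p ^ n * p ^ (2 * n + n))%N.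
      by rewrite -expnD; congr (_ ^ _)%N; ring.
    rewrite dvdn_mul ?pfactor_dvdnn //.
    have := gap_pfactor p_pr p_odd n0 (pfactor_dvdnn p j.-1) (pfactor_dvdnn p y).
    by rewrite prednK // yn.
  have : a ^+ (i.-1 * t)%N = 1.
    apply: (mulgI (a ^+ t)); rewrite mulg1 -expgD -mulSn prednK //.
    rewrite expgM -ac -conjXg -E conjMg conjXg.
    rewrite [(c ^+ y) ^ c](_ : _ = c ^+ y); last by rewrite conjgE -expgSr expgS mulKg.
    rewrite [in RHS]Eb1 -expgM.
    have -> : (j * gap j y = gap j y + j.-1 * gap j y)%N by rewrite -mulSn prednK.
    by rewrite expgD b1 mulg1.
  move/(p_elt_expg_eq1 pa); rewrite muln_gt0 i1 t0 => /(_ isT).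
  by rewrite lognM // tn addnA addnn -mul2n.
pose x' := (#[a].-1 * x)%N.
have Dx' : a ^+ x' = a ^- x by rewrite /x' expgM -invg_expg expgVn.
have px' : p ^ (2 * m) %| x' by rewrite dvdn_mull.
have R' : c ^+ s = b ^+ y * a ^+ x' by rewrite Dx' -R mulgK.
pose b2 := b ^ (c ^+ s).
have Eb2 : b = b2 ^+ (j ^ s)%N := conj_comm_expnV ab s.
pose t' := (j ^ s - 1)%N.
have Dt' : (j ^ s = t'.+1)%N by rewrite /t' subn1 prednK // expn_gt0 j0.
have tn' : logn p t' = (2 * n)%N.
  by rewrite /t' -(prednK j0) logn_pred_exp // ij -/n mul2n addnn.
have t0' : 0 < t'.
  by case: (t') tn' => // /eqP; rewrite logn0 eq_sym muln_eq0 /= eqn0Ngt n0.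
(* Conjugate [b] by [c ^+ s = b ^+ y * a ^+ x']: the factor [a ^+ gap i x'] vanishes by [a21], so
   [b2 = b * c ^- x'], while [b = b2 ^+ t'.+1]. *)
have Ec : c ^+ x' = b2 ^+ t'.
  have : b2 = b * c ^- x'.
    rewrite /b2 R' conjgM [b ^ _](_ : _ = b); last by apply/conjg_fixP/commgP/commuteX.
    rewrite (conj_expg_gap (relsC ab) _ i0) -invg_comm -/c expgVn.
    rewrite (expg_eq1_dvd a21) ?mulg1 //.
    apply: (@dvdn_trans (p ^ (2 * m + m))); first by rewrite dvdn_exp2l // leq_add2l.
    have := gap_pfactor p_pr p_odd (leq_trans n0 nm) (pfactor_dvdnn p i.-1) px'.
    by rewrite prednK.
  move=> E; apply: (mulgI b2); rewrite -expgS -Dt' -Eb2.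
  by rewrite {1}E mulgKV.
have pb2 : p.-elt b2 by rewrite /b2 p_eltJ.
have [k Dk] : exists k, b ^+ y = c ^+ (x' * k)%N.
  have [|w Dw] := @p_elt_expg_cycle _ b2 p t' (j ^ s * y) p_pr pb2 t0'.
    by rewrite tn' -yn dvdn_mull // pfactor_dvdnn.
  by exists w; rewrite {1}Eb2 -expgM Dw expgM -Ec -expgM.
(* Now [b ^+ y] is a power of [c], so [a ^+ x'] is too. Its exponent [s - x' * k], encoded by [z],
   still has valuation [n], since [n < 2 * m]. *)
pose z := (s + #[c].-1 * (x' * k))%N.
have Ez : a ^+ x' = c ^+ z.
  rewrite /z expgD [in RHS]expgM -invg_expg expgVn.
  have -> : c ^+ s * c ^- (x' * k) = c ^- (x' * k) * c ^+ s.
    by apply: commuteV; apply: commuteX2.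
  by rewrite R' -Dk mulKg.
have sn : p ^ n.+1 %| #[c].-1 * (x' * k).
  rewrite dvdn_mull // dvdn_mulr // (dvdn_trans _ px') // dvdn_exp2l //.
  rewrite mul2n -addnn (leq_trans (_ : n.+1 <= m.+1)) //.
  by rewrite -[X in X < _]addn0 ltn_add2l (leq_trans n0).
have zn : logn p z = n by rewrite /z logn_addl ?ij.
have z0 : 0 < z by rewrite addn_gt0 s0.
(* As [c ^+ s] is a power of [c ^+ z = a ^+ x'], it centralizes [a], whence
   [a ^+ (i ^ s - 1) = 1]. *)
have amn : a ^+ (p ^ (m + n))%N = 1.
  have [|w Dw] := p_elt_expg_cycle (l := s) p_pr pc z0.
    by rewrite zn -ij pfactor_dvdnn.
  rewrite -tn; apply: p_elt_expg_eq1 => //; apply: (mulgI a).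
  rewrite mulg1 -expgS -Dt -(conj_comm_expn ab) -/c Dw expgM -Ez -expgM.
  by apply/conjg_fixP/commgP/commuteX.
have ax' : a ^+ x' = 1.
  by rewrite (expg_eq1_dvd amn) // (dvdn_trans _ px') // dvdn_exp2l // mul2n -addnn leq_add2l.
have cn : c ^+ (p ^ n)%N = 1.
  by rewrite -zn; apply: p_elt_expg_eq1 => //; rewrite -Ez.
split=> //; rewrite -yn; apply: p_elt_expg_eq1 => //.
have := R'; rewrite ax' mulg1 => <-.
by rewrite (expg_eq1_dvd cn) // -ij pfactor_dvdnn.
Qed.
End Orders.

(** * Order and class bounds *)

(** Conjugation by [b] replaces the exponent [p ^ e] by [i * geo i (p ^ e)], which agrees with it
    modulo [p ^ (e + e)]. *)
Lemma commute_expg_pfactor (gT : finGroupType) (a b : gT) i j p e :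
  rels a b i j -> prime p -> odd p -> 0 < i -> 0 < e -> p ^ e %| i.-1 ->
  a ^+ (p ^ (e + e))%N = 1 -> [~ a, b] ^+ (p ^ e)%N = 1 ->
  commute (a ^+ (p ^ e)%N) b.
Proof.
move=> ab p_pr p_odd i0 e0 pd a1 c1; apply/commgP/conjg_fixP.
rewrite (conj_expg_geo ab) c1 mul1g.
have [u] := geo_pfactor p_pr p_odd e0 pd (dvdnn (p ^ e)); rewrite prednK // => ->.
case/dvdnP: pd => w Dw.
rewrite -{1}(prednK i0) Dw (_ : (_ * _ = p ^ e + p ^ (e + e) * (u + w * (1 + p ^ e * u)))%N).
  by rewrite expgD (expgM _ (p ^ (e + e))) a1 expg1n mulg1.
rewrite expnD; ring.
Qed.

Lemma leq_card_joing (gT : finGroupType) (H K : {group gT}) :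
  K \subset 'N(H) -> #|H <*> K| <= #|H| * #|K|.
Proof. by move=> nHK; rewrite norm_joinEr // mul_cardG leq_pmulr ?cardG_gt0. Qed.

Lemma leq_order (gT : finGroupType) (x : gT) k : 0 < k -> x ^+ k = 1 -> #[x] <= k.
Proof. by move=> k0 /eqP; rewrite -order_dvdn; apply: dvdn_leq. Qed.

Lemma commute_cycle_norm (gT : finGroupType) (x y : gT) :
  commute x y -> <[y]> \subset 'N(<[x]>).
Proof. by move=> xy; rewrite cents_norm // cycle_subG /= cent_cycle; apply/cent1P. Qed.

Section Structure.
Variables (gT : finGroupType) (a b : gT) (k l h : nat).
Let c := [~ a, b].
Let P := <<[set a; b]>>.
Hypotheses (k0 : 0 < k) (l0 : 0 < l) (h0 : 0 < h).
Hypotheses (akb : commute (a ^+ k) b) (bla : commute (b ^+ l) a).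
Hypotheses (ac : [~ a, c] \in <[a ^+ k]>) (bc : [~ b, c] \in <[b ^+ l]>).

Let aP : a \in P. Proof. by rewrite mem_gen // !inE eqxx. Qed.
Let bP : b \in P. Proof. by rewrite mem_gen // !inE eqxx orbT. Qed.
Let cP : c \in P. Proof. by rewrite groupR. Qed.
(** In [1 <= Z0 <= Z1 <= P] every factor is central: [Z0] is central in [P], [Z1] is central modulo
    [Z0], and [P / Z1] is abelian. It is applied with [k = p ^ m] and [l = h = p ^ n]. *)
Let Z0 := <[a ^+ k]> <*> <[b ^+ l]>.
Let Z1 := Z0 <*> <[c]>.

Let Z0_cent : Z0 \subset 'Z(P).
Proof.
rewrite subsetI !join_subG !cycle_subG !(groupX _ aP) !(groupX _ bP) /= cent_gen.
apply/andP; split; apply/centP => x; rewrite !inE => /orP[] /eqP->;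
  by [|apply/commute_sym/commuteX].
Qed.

Let Z0_norm : P \subset 'N(Z0).
Proof. by rewrite cents_norm // centsC (subset_trans Z0_cent) // subsetIr. Qed.

Let Z1_comm : [~: Z1, P] \subset Z0.
Proof.
have nZ0 x : x \in P -> x \in 'N(Z0) by apply: subsetP.
have nc : <[c]> \subset 'N(Z0) by rewrite cycle_subG nZ0.
have nZ1 : Z1 \subset 'N(Z0) by rewrite join_subG normG.
rewrite -quotient_cents2 //.
rewrite quotientYidl // quotient_cycle ?nZ0 // cycle_subG.
rewrite quotient_gen2 ?nZ0 //= cent_gen.
apply/centP => x; rewrite !inE => /orP[] /eqP->; apply/commute_sym/commgP;
  rewrite -morphR ?nZ0 //; apply/eqP; apply: coset_id.
  by apply: subsetP ac; rewrite joing_subl.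
by apply: subsetP bc; rewrite joing_subr.
Qed.

Let Z1_norm : P \subset 'N(Z1).
Proof. by rewrite -commg_subl (subset_trans Z1_comm) // joing_subl. Qed.

Let Z1_quo : P / Z1 = <<[set coset Z1 a; coset Z1 b]>>.
Proof.
have nZ1 x : x \in P -> x \in 'N(Z1) by apply: subsetP.
by rewrite quotient_gen2 ?nZ1.
Qed.

Let Z1_quo_comm : commute (coset Z1 a) (coset Z1 b).
Proof.
have nZ1 x : x \in P -> x \in 'N(Z1) by apply: subsetP.
apply/commgP; rewrite -morphR ?nZ1 //; apply/eqP; apply: coset_id.
by rewrite -cycle_subG joing_subr.
Qed.

Lemma nil_class_gen2_le3 : nilpotent P -> nil_class P <= 3.
Proof.
move=> nilP; apply/lcn_nil_classP => //.
have L2 : 'L_2(P) \subset Z1.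
  rewrite lcn2 der1_min // Z1_quo abelian_gen; apply/centsP.
  by move=> x + y; rewrite !inE => /orP[]/eqP-> /orP[]/eqP->.
have L3 : 'L_3(P) \subset Z0.
  exact: subset_trans (commSg _ L2) Z1_comm.
apply/commG1P; apply: subset_trans L3 (subset_trans Z0_cent _); exact: subsetIr.
Qed.

Lemma card_gen2_le : a ^+ (k * h)%N = 1 -> b ^+ (l * h)%N = 1 -> c ^+ h = 1 ->
  #|P| <= h * h * h * (k * l).
Proof.
move=> akh blh ch.
have nZ1 x : x \in P -> x \in 'N(Z1) by apply: subsetP.
rewrite -(Lagrange (_ : Z1 \subset P)); last first.
  by rewrite !join_subG !cycle_subG ?groupX.
rewrite -card_quotient // Z1_quo leq_mul //.
  apply: leq_trans (leq_card_joing _) _.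
    by rewrite cycle_subG (subsetP Z0_norm).
  rewrite leq_mul ?leq_order //.
  apply: leq_trans (leq_card_joing _) _.
    by apply/commute_cycle_norm/commuteX.
  by rewrite leq_mul ?leq_order // -expgM.
have -> : <<[set coset Z1 a; coset Z1 b]>> = <[coset Z1 a]> <*> <[coset Z1 b]>.
  by rewrite joing_idl joing_idr.
apply: leq_trans (leq_card_joing _) _.
  exact: commute_cycle_norm.
rewrite leq_mul ?leq_order // -morphX ?nZ1 //; apply: coset_id.
  by rewrite (subsetP (joing_subl _ _)) // (subsetP (joing_subl _ _)) // cycle_id.
by rewrite (subsetP (joing_subl _ _)) // (subsetP (joing_subr _ _)) // cycle_id.
Qed.

End Structure.

(** * A permutation model *)

Section Model.
Local Open Scope ring_scope.
Variables (p m n d e : nat).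
Hypotheses (p_pr : prime p) (p_odd : odd p) (n0 : (0 < n)%N) (nm : (n <= m)%N).
Hypotheses (pd : (p ^ m %| d)%N) (pe : (p ^ n %| e)%N).

Let q := (p ^ (m + n))%N.
Let r := (p ^ n)%N.
Let r1 : (1 < r)%N.
Proof. by rewrite -(exp1n n) ltn_exp2r // prime_gt1. Qed.
Let rq : (r %| q)%N.
Proof. by rewrite dvdn_exp2l // leq_addl. Qed.
Let q1 : (1 < q)%N.
Proof. by rewrite (leq_trans r1) // dvdn_leq // expn_gt0 prime_gt0. Qed.

Let natr_eq0 s t : (1 < s)%N -> (t%:R == 0 :> 'Z_s) = (s %| t)%N.
Proof. by move=> s1; rewrite -val_eqE /= val_Zp_nat. Qed.

Let X : finType := ('Z_q * 'Z_r * 'Z_r)%type.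

(** Multiplication by [d] through a lift of [k] to the naturals; the lift does not matter because
    [q] divides [r * d]. *)
Let delta (k : 'Z_r) : 'Z_q := (k * d)%:R.

Let delta_nat t : delta t%:R = (t * d)%:R.
Proof.
rewrite /delta val_Zp_nat //.
have E : (t * d = t %% r * d + t %/ r * (r * d))%N.
  by rewrite {1}(divn_eq t r); ring.
rewrite [in RHS]E natrD -[LHS]addr0; congr (_ + _); apply/esym/eqP.
rewrite natr_eq0 // dvdn_mull // /q addnC expnD dvdn_mul //.
Qed.

Let deltaD k l : delta (k + l) = delta k + delta l.
Proof.
rewrite -[k in LHS]natr_Zp -[l in LHS]natr_Zp -natrD delta_nat mulnDl natrD.
by [].
Qed.

Let delta_pm t k : (p ^ m %| t)%N -> t%:R * delta k = 0.
Proof.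
move=> pt; rewrite /delta -natrM; apply/eqP; rewrite natr_eq0 // mulnCA dvdn_mull //.
by rewrite /q (dvdn_trans (dvdn_exp2l p (_ : _ <= m + m)%N)) ?leq_add2l // expnD dvdn_mul.
Qed.

(* With [delta k = (alpha - 1) k], these are the right multiplications by [a],
   [b] and [c] on the normal forms [a ^+ x * b ^+ j * c ^+ k] of the quotient
   by [b ^+ (p ^ n)]. *)
Let fA (v : X) : X := (v.1.1 + 1 - delta v.2, v.1.2, v.2 - v.1.2).
Let fB (v : X) : X := (v.1.1, v.1.2 + 1, v.2).
Let fC (v : X) : X := (v.1.1, v.1.2, v.2 + 1).

Let fA_inj : injective fA.
Proof.
apply: (can_inj (g := fun v => (v.1.1 - 1 + delta (v.2 + v.1.2), v.1.2, v.2 + v.1.2))).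
by case=> [[x j] k]; rewrite /fA /= subrK; congr (_, _, _); ring.
Qed.

Let fB_inj : injective fB.
Proof.
apply: (can_inj (g := fun v => (v.1.1, v.1.2 - 1, v.2))).
by case=> [[x j] k]; rewrite /fB /= addrK.
Qed.

Let fC_inj : injective fC.
Proof.
apply: (can_inj (g := fun v => (v.1.1, v.1.2, v.2 - 1))).
by case=> [[x j] k]; rewrite /fC /= addrK.
Qed.

Let A := perm fA_inj.
Let B := perm fB_inj.
Let C := perm fC_inj.

Let commAB : [~ A, B]%g = C.
Proof.
apply: (mulgI (B * A)%g); rewrite -commgC; apply/permP => v.
rewrite !permM !permE /fA /fB /fC /=; congr (_, _, _).
by rewrite opprD addrA subrK.
Qed.

(** Each step lowers the last coordinate by [v.1.2]; the accumulated corrections to [delta] give the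
    ['C(t, 2)] term. *)
Let AX t v : (A ^+ t)%g v =
  (v.1.1 + t%:R - t%:R * delta v.2 + ('C(t, 2))%:R * delta v.1.2, v.1.2, v.2 - t%:R * v.1.2).
Proof.
elim: t => [|t IH].
  by rewrite expg0 perm1 bin0n !mul0r !subr0 !addr0; case: v => [[]].
rewrite expgSr permM IH permE /fA /= binS bin1 !natrD.
have deltaN k : delta (- k) = - delta k.
  apply/eqP; rewrite -addr_eq0 -deltaD addNr; have := delta_nat 0.
  by rewrite mul0n => ->.
have deltaM k : delta (t%:R * k) = t%:R * delta k.
  elim: (t) => [|s IHs]; first by rewrite !mul0r; have := delta_nat 0; rewrite mul0n.
  by rewrite -!natr1 !mulrDl !mul1r deltaD IHs.
rewrite deltaD deltaN deltaM -natr1.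
congr (_, _, _); ring.
Qed.

Let BX t v : (B ^+ t)%g v = (v.1.1, v.1.2 + t%:R, v.2).
Proof.
elim: t => [|t IH]; first by rewrite expg0 perm1 addr0; case: v => [[]].
by rewrite expgSr permM IH permE /fB /= -natr1 addrA.
Qed.

Let CX t v : (C ^+ t)%g v = (v.1.1, v.1.2, v.2 + t%:R).
Proof.
elim: t => [|t IH]; first by rewrite expg0 perm1 addr0; case: v => [[]].
by rewrite expgSr permM IH permE /fC /= -natr1 addrA.
Qed.

Let pd2 : (p ^ m %| 'C(d.+1, 2))%N.
Proof.
by rewrite -(@Gauss_dvdr _ 2) ?coprimeXl ?coprimen2 // double_bin2 dvdn_mull.
Qed.

Let rd : d%:R = 0 :> 'Z_r.
Proof. by apply/eqP; rewrite natr_eq0 // (dvdn_trans _ pd) // dvdn_exp2l. Qed.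

(** In [A ^+ d.+1] the [delta] terms with coefficients [d] and ['C(d.+1, 2)] vanish, both being
    divisible by [p ^ m]. [B] commutes with [C], and [e] is 0 modulo [p ^ n]. *)
Let rels_model : rels A B d.+1 e.+1.
Proof.
split.
  rewrite commAB; apply: (mulgI C); rewrite -conjgC; apply/permP => v.
  rewrite !permM AX !permE /fA /fC /=; congr (_, _, _).
    rewrite (delta_pm _ pd2) addr0 -natr1 mulrDl (delta_pm _ pd) deltaD.
    have := delta_nat 1; rewrite mul1n => ->; ring.
  rewrite -natr1 rd; ring.
rewrite -invg_comm commAB.
have -> : (B ^ C^-1 = B)%g.
  apply/conjg_fixP/commgP/commuteV; apply/permP => v.
  by rewrite !permM !permE.
apply/permP => v; rewrite BX permE /fB; congr (_, _ + _, _).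
rewrite -natr1 (_ : e%:R = 0) ?add0r //.
by apply/eqP; rewrite natr_eq0.
Qed.

Lemma rels_model_exists : exists (hT : finGroupType) (x y : hT),
  [/\ rels x y d.+1 e.+1, #[x]%g = (p ^ (m + n))%N, (y ^+ (p ^ n))%g = 1%g
    & (p ^ n %| #[[~ x, y]]%g)%N /\ (p ^ (m + n + n + n) <= #|<<[set x; y]>>%g|)%N].
Proof.
exists {perm X}, A, B; split=> //.
- apply/eqP; rewrite eqn_dvd; apply/andP; split.
    rewrite order_dvdn; apply/eqP.
    apply/permP => v; rewrite AX perm1.
    have q0 : q%:R = 0 :> 'Z_q by apply/eqP; rewrite natr_eq0.
    have q0' : q%:R = 0 :> 'Z_r by apply/eqP; rewrite natr_eq0.
    rewrite bin2odd ?oddX ?p_odd ?orbT // natrM q0 q0' !mul0r subr0 !addr0 subr0.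
    by case: v => [[]].
  rewrite -natr_eq0 //; have := AX #[A]%g (0, 0, 0).
  rewrite expg_order perm1 /= => /(congr1 (fun v : X => v.1.1)) /= /esym.
  have := delta_nat 0; rewrite mul0n => ->.
  by rewrite !mulr0 subr0 add0r addr0 => /eqP.
- apply/permP => v; rewrite BX perm1.
  have -> : (p ^ n)%:R = 0 :> 'Z_r by apply/eqP; rewrite natr_eq0.
  by rewrite addr0; case: v => [[]].
split.
  rewrite commAB -natr_eq0 //; have := CX #[C]%g (0, 0, 0).
  rewrite expg_order perm1 /= => /(congr1 (fun v : X => v.2)) /= /esym.
  by rewrite add0r => /eqP.
have <- : #|X| = (p ^ (m + n + n + n))%N.
  rewrite !card_prod !card_ord (Zp_cast r1) (Zp_cast q1).
  by rewrite expnD [(p ^ (m + n + n))%N]expnD.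
have AG : A \in <<[set A; B]>>%g by rewrite mem_gen // !inE eqxx.
have BG : B \in <<[set A; B]>>%g by rewrite mem_gen // !inE eqxx orbT.
(* The group is transitive: [A ^+ x * B ^+ j * C ^+ k] sends the origin to [(x, j, k)]. *)
apply: leq_trans (leq_imset_card (fun g : {perm X} => g (0, 0, 0)) _).
rewrite -cardsT subset_leq_card //; apply/subsetP => -[[x j] k] _.
apply/imsetP; exists (A ^+ x * B ^+ j * C ^+ k)%g.
  by rewrite -commAB !groupM ?groupX // groupR.
rewrite !permM AX BX CX /=; have := delta_nat 0; rewrite mul0n => ->.
by rewrite !mulr0 !subr0 !add0r addr0 !natr_Zp.
Qed.

End Model.

(** * Sylow subgroups and integer exponents *)

Lemma zexpg_eq (gT : finGroupType) (x : gT) (z : int) k :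
  (#[x] %| (k%:Z - z)%R)%Z -> zexpg x z = x ^+ k.
Proof.
case: z => l /=; first by rewrite -eqz_mod_dvd !modz_nat eqz_nat => /eqP E;
  apply/esym/eqP; rewrite eq_expg_mod_order E.
rewrite NegzE opprK -PoszD => h; apply: (mulIg (x ^+ l.+1)).
by rewrite mulVg -expgD; apply/esym/eqP; rewrite -order_dvdn.
Qed.

(** This carries the valuations of the integer parameters over to natural representatives. *)
Lemma logn_absz_cong p (x y : int) : prime p -> (x != 0)%R ->
  ((p ^ (logn p `|x|).+1)%N %| (y - x)%R)%Z -> logn p `|y|%N = logn p `|x|%N.
Proof.
move=> p_pr x0; set e := logn p _ => pyx.
have ax0 : 0 < `|x|%N by rewrite absz_gt0.
have dvdP f : f <= e.+1 -> (p ^ f %| `|y|)%N = (p ^ f %| `|x|)%N.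
  move=> fe; have pf : ((p ^ f)%N %| (y - x)%R)%Z.
    by apply: dvdz_trans pyx; rewrite dvdzE /= dvdn_exp2l.
  have -> : (p ^ f %| `|y|)%N = ((p ^ f)%N %| y)%Z by [].
  by rewrite -(subrK x y) rpredDl.
have y0 : 0 < `|y|%N.
  rewrite lt0n; apply/eqP => y0; have := dvdP e.+1 (leqnn _).
  by rewrite y0 dvdn0 pfactor_dvdn // ltnn.
apply/eqP; rewrite eqn_leq leqNgt -!pfactor_dvdn // !dvdP //.
by rewrite !pfactor_dvdn // ltnn leqnn.
Qed.

(** In a nilpotent group the [pi]-part is the projection onto a direct factor; for a single prime
    this is the canonical map onto the Sylow subgroup. *)
Lemma constt_nilM (gT : finGroupType) (G : {group gT}) pi : nilpotent G ->
  {in G &, {morph (fun x : gT => x.`_pi) : x y / x * y}}.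
Proof.
move=> nilG x y xG yG; have defG := nilpotent_pcoreC pi nilG.
have Hpi := nilpotent_pcore_Hall pi nilG.
have Hpi' := nilpotent_pcore_Hall pi^' nilG.
have inO z : z \in G -> z.`_pi \in 'O_pi(G).
  by move=> zG; rewrite (mem_normal_Hall Hpi) ?pcore_normal ?p_elt_constt ?groupX.
have inO' z : z \in G -> z.`_pi^' \in 'O_pi^'(G).
  by move=> zG; rewrite (mem_normal_Hall Hpi') ?pcore_normal ?p_elt_constt ?groupX.
have [_ _ cO _] := dprodP defG.
have cO2 u v : u \in 'O_pi(G) -> v \in 'O_pi^'(G) -> commute u v.
  by move=> uO vO; apply/esym; apply: (centsP cO).
have xyE : x * y = (x.`_pi * y.`_pi) * (x.`_pi^' * y.`_pi^').
  rewrite -{1}(consttC pi x) -{1}(consttC pi y) -!mulgA; congr (_ * _).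
  by rewrite !mulgA; congr (_ * _); apply/esym/cO2; rewrite ?inO ?inO'.
rewrite {1}xyE consttM; last by apply: cO2; rewrite groupM ?inO ?inO'.
have -> : (x.`_pi^' * y.`_pi^').`_pi = 1.
  apply/constt1P; apply: (mem_p_elt (pcore_pgroup pi^' G)).
  by rewrite groupM ?inO'.
rewrite mulg1 constt_p_elt //; apply: (mem_p_elt (pcore_pgroup pi G)).
by rewrite groupM ?inO.
Qed.

Lemma sylow_gen2 (gT : finGroupType) (A B : gT) i j p (P : {group gT}) :
  rels A B i j -> nilpotent <<[set A; B]>> -> p.-Sylow(<<[set A; B]>>) P ->
  [/\ rels A.`_p B.`_p i j, P = <<[set A.`_p; B.`_p]>> :> {set gT}
    & [~ A, B].`_p = [~ A.`_p, B.`_p] ].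
Proof.
move=> AB nilG sylP; set G := <<[set A; B]>> in nilG sylP.
have AG : A \in G by rewrite mem_gen // !inE eqxx.
have BG : B \in G by rewrite mem_gen // !inE eqxx orbT.
pose f := Morphism (constt_nilM p nilG).
have fE x : x \in G -> f x = x.`_p by [].
have fR : f [~ A, B] = [~ f A, f B] by rewrite morphR.
split.
- case: AB => h1 h2; split; rewrite -!fE // -morphR // -morphJ ?groupR //.
    by rewrite h1 morphX.
  by rewrite h2 morphX.
- have -> : <<[set A.`_p; B.`_p]>> = f @* G.
    rewrite morphim_gen; last by apply/subsetP => x /set2P[]->.
    by rewrite morphimU !morphim_set1.
  apply/eqP; rewrite eqEsubset; apply/andP; split; apply/subsetP => x.
    move=> xP; have xG := subsetP (pHall_sub sylP) x xP.
    have Ex : f x = x := constt_p_elt (mem_p_elt (pHall_pgroup sylP) xP).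
    by rewrite -Ex mem_morphim.
  case/morphimP => y _ yG ->; rewrite (nilpotent_Hall_pcore nilG sylP) /=.
  rewrite (mem_normal_Hall (nilpotent_pcore_Hall p nilG)) ?pcore_normal //.
    by rewrite p_elt_constt.
  by rewrite groupX.
- by rewrite -!fE ?groupR.
Qed.

(** * Upper and lower bounds for the Sylow subgroup *)

Lemma upper_bounds (gT : finGroupType) (a b : gT) i j p :
  let P := <<[set a; b]>> in
  let m := logn p i.-1 in let n := logn p j.-1 in
  rels a b i j -> prime p -> odd p -> p.-group P ->
  0 < n -> n <= m -> j < i -> logn p (i - j) = n -> logn p (gap j j) = (2 * n)%N ->
  [/\ a ^+ (p ^ (m + n))%N = 1, b ^+ (p ^ (2 * n))%N = 1,
      [~ a, b] ^+ (p ^ n)%N = 1, #|P| <= p ^ (4 * n + m) & nil_class P <= 3].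
Proof.
move=> P m n ab p_pr p_odd pP n0 nm ji ij gj.
have aP : a \in P by rewrite mem_gen // !inE eqxx.
have bP : b \in P by rewrite mem_gen // !inE eqxx orbT.
have cP : [~ a, b] \in P by rewrite groupR.
have pelt x : x \in P -> p.-elt x by apply: mem_p_elt.
have m0 := leq_trans n0 nm.
have i1 : 0 < i.-1 by move: m0; rewrite logn_gt0 mem_primes => /and3P[].
have j1 : 0 < j.-1 by move: n0; rewrite logn_gt0 mem_primes => /and3P[].
have i0 : 0 < i by case: (i) i1.
have j0 : 0 < j by case: (j) j1.
have [a1 b1 c1] := expg_gen_orders ab p_pr p_odd (pelt _ aP) (pelt _ bP)
  (pelt _ cP) n0 nm ji ij gj.
rewrite -/m -/n in a1 b1 c1.
have amb : commute (a ^+ (p ^ m)%N) b.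
  apply: (commute_expg_pfactor ab p_pr p_odd i0 m0 (pfactor_dvdnn _ _)).
    by apply: expg_eq1_dvd a1 _; rewrite dvdn_exp2l // leq_add2l.
  by apply: expg_eq1_dvd c1 _; rewrite dvdn_exp2l.
have bna : commute (b ^+ (p ^ n)%N) a.
  apply: (commute_expg_pfactor (relsC ab) p_pr p_odd j0 n0 (pfactor_dvdnn _ _)).
    by rewrite addnn -mul2n.
  by rewrite -invg_comm expgVn c1 invg1.
have [ac bc] : a ^ [~ a, b] = a ^+ i /\ b ^ [~ a, b]^-1 = b ^+ j.
  by rewrite invg_comm.
have aZ : [~ a, [~ a, b]] \in <[a ^+ (p ^ m)%N]>.
  rewrite commgEl ac -{1}(prednK i0) expgS mulKg.
  by have /dvdnP[w ->] := pfactor_dvdnn p i.-1; rewrite mulnC expgM mem_cycle.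
have bZ : [~ b, [~ a, b]] \in <[b ^+ (p ^ n)%N]>.
  (* The relation controls the commutator with the inverse of [c]; conjugation by [c], which fixes
     this central power of [b], passes to [[~ b, c]]. *)
  have E : [~ b, [~ a, b]^-1] = b ^+ j.-1.
    by rewrite commgEl bc -{1}(prednK j0) expgS mulKg.
  have [w Dw] : exists w, b ^+ j.-1 = (b ^+ (p ^ n)) ^+ w.
    have /dvdnP[w Dw] := pfactor_dvdnn p j.-1; exists w.
    by rewrite {1}Dw mulnC expgM.
  have bn : commute (b ^+ (p ^ n)%N) [~ a, b].
    rewrite commgEl conjgE; do !apply: commuteM => //; try apply: commuteV => //;
      by apply/commute_sym/commuteX.
  have -> : [~ b, [~ a, b]] = ([~ b, [~ a, b]^-1])^-1.
    have /commgP/conjg_fixP F : commute [~ b, [~ a, b]^-1] [~ a, b].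
      by rewrite E Dw; apply/commute_sym/commuteX/commute_sym.
    rewrite -F !commgEl conjMg conjVg -conjgM mulVg conjg1 invMg invgK.
    by [].
  by rewrite E Dw groupV mem_cycle.
have p0 k : 0 < p ^ k by rewrite expn_gt0 prime_gt0.
split=> //.
  have -> : (p ^ (4 * n + m) = p ^ n * p ^ n * p ^ n * (p ^ m * p ^ n))%N.
    by rewrite -!expnD; congr (_ ^ _)%N; ring.
  apply: card_gen2_le => //; first by rewrite -expnD.
  by rewrite -expnD addnn -mul2n.
by apply: (@nil_class_gen2_le3 _ _ _ (p ^ m)%N (p ^ n)%N) => //; apply: pgroup_nil pP.
Qed.

Lemma Grels_rels (gT : finGroupType) (x y : gT) (alpha beta : int) i j :
  (#[x] %| (i%:Z - alpha)%R)%Z -> (#[y] %| (j%:Z - beta)%R)%Z ->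
  Grels x y alpha beta <-> rels x y i j.
Proof. by move=> xi yj; rewrite /Grels (zexpg_eq xi) (zexpg_eq yj). Qed.

(** The window index [k] allows representatives of two integers to be chosen in a prescribed
    order. *)
Lemma nat_repr (T : nat) (z : int) k : 0 < T ->
  exists2 i : nat, (T %| (i%:Z - z)%R)%Z & k * T <= i < k.+1 * T.
Proof.
move=> T0; exists (`|(z %% T)%Z| + k * T)%N.
  rewrite PoszD gez0_abs ?modz_ge0 -?lt0n //.
  rewrite {2}(divz_eq z T) PoszM.
  have -> : ((z %% T)%Z + k%:Z * T - ((z %/ T)%Z * T + (z %% T)%Z) =
     (k%:Z - (z %/ T)%Z) * T :> int)%R by ring.
  by rewrite dvdz_mull.
have := ltz_pmod z (T0 : (0 < T%:Z)%R); have := modz_ge0 z (lt0r_neq0 (T0 : (0 < T%:Z)%R)).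
by rewrite leq_addl mulSn ltn_add2r /=; case: (z %% T)%Z.
Qed.

Lemma is_Gab_lower (gT : finGroupType) (A B : gT) alpha beta i j p m n :
  is_Gab A B alpha beta -> prime p -> odd p -> 0 < n -> n <= m ->
  0 < i -> 0 < j ->
  p ^ m %| i.-1 -> p ^ n %| j.-1 ->
  ((p ^ (m + n))%N %| (i%:Z - alpha)%R)%Z -> ((p ^ (m + n))%N %| (j%:Z - beta)%R)%Z ->
  [/\ p ^ (m + n) %| #[A.`_p], p ^ n %| #[[~ A.`_p, B.`_p]],
      p ^ (n + n) %| #[B.`_p]
    & p ^ (m + n + n + n) * #[B.`_p ^+ (p ^ n)] <= #|<<[set A.`_p; B.`_p]>>|].
Proof.
move=> [_ [_ univ]] p_pr p_odd n0 nm i0 j0 pi pj iT jT.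
have dvdT k z : (k <= m + n)%N -> ((p ^ (m + n))%N %| z)%Z -> ((p ^ k)%N %| z)%Z.
  by move=> kl; apply: dvdz_trans; rewrite dvdzE /= dvdn_exp2l.
have pelt (hT : finGroupType) (x : hT) k : x ^+ (p ^ k)%N = 1 -> p.-elt x.
  move/eqP; rewrite -order_dvdn => /pnat_dvd; apply.
  by rewrite pnatX pnat_id.
have morphp (hT : finGroupType) (f : {morphism [set: gT] >-> hT}) z :
    f z.`_p = (f z).`_p by rewrite morph_constt ?inE.
have [H1 [x [y [xy ox y1 [oc leX]]]]] := rels_model_exists p_pr p_odd n0 nm pi pj.
rewrite !prednK // in xy.
have /univ [f [fA fB]] : Grels x y alpha beta.
  apply/(Grels_rels (i := i) (j := j)) => //; first by rewrite ox.
  apply: dvdz_trans (dvdT n _ (leq_addl _ _) jT).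
  by rewrite dvdzE /= order_dvdn y1.
have fa : f A.`_p = x.
  by rewrite morphp fA constt_p_elt // (pelt _ _ (m + n)%N) // -ox expg_order.
have fb : f B.`_p = y by rewrite morphp fB constt_p_elt // (pelt _ _ n).
have ob2 : p ^ (n + n) %| #[B.`_p].
  have pin : p ^ n %| i.-1 by apply: dvdn_trans pi; rewrite dvdn_exp2l.
  (* The model with the generators exchanged and both exponents equal to [n], allowed since [p ^ n]
     divides [i.-1]. *)
  have [H2 [x2 [y2 [xy2 ox2 y21 _]]]] := rels_model_exists p_pr p_odd n0 (leqnn n) pj pin.
  rewrite !prednK // in xy2.
  have /univ [g [gA gB]] : Grels y2 x2 alpha beta.
    apply/(Grels_rels (i := i) (j := j)); last exact: relsC.
      apply: dvdz_trans (dvdT n _ (leq_addl _ _) iT).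
      by rewrite dvdzE /= order_dvdn y21.
    by rewrite ox2; apply: dvdT jT; rewrite leq_add2r.
  rewrite -ox2; have <- : g B.`_p = x2.
    by rewrite morphp gB constt_p_elt // (pelt _ _ (n + n)%N) // -ox2 expg_order.
  by rewrite morph_order ?inE.
split=> //.
- by rewrite -ox -fa morph_order ?inE.
- apply: dvdn_trans oc _.
  by rewrite -fa -fb -morphR ?inE // morph_order ?inE.
set P := <<_>>.
rewrite -(LagrangeI P ('ker f)) mulnC leq_mul //.
  apply/subset_leq_card; rewrite cycle_subG; apply/setIP; split.
    by rewrite groupX // mem_gen // !inE eqxx orbT.
  by apply/(kerP _ (in_setT _)); rewrite morphX ?inE // fb y1.
apply: leq_trans leX _.
have -> : <<[set x; y]>> = f @* P.
  by rewrite morphim_gen ?subsetT // morphimU !morphim_set1 ?inE // fa fb.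
by rewrite card_morphim setTI.
Qed.

(** In class at most 2 the commutator centralizes [a], so [a ^+ i = a]. This later contradicts the
    order of [a]. *)
Lemma expg_eq1_nil_class_le2 (gT : finGroupType) (a b : gT) i j :
  rels a b i j -> nilpotent <<[set a; b]>> -> 0 < i ->
  nil_class <<[set a; b]>> <= 2 -> a ^+ i.-1 = 1.
Proof.
move=> [ac _] nilP i0 /(lcn_nil_classP _ nilP) L3.
have aP : a \in <<[set a; b]>> by rewrite mem_gen // !inE eqxx.
have bP : b \in <<[set a; b]>> by rewrite mem_gen // !inE eqxx orbT.
have : [~ [~ a, b], a] \in 'L_3(<<[set a; b]>>) by do 2?apply: mem_commg.
rewrite L3 => /set1P/eqP/commgP/commute_sym/commgP/conjg_fixP.
rewrite ac -{1}(prednK i0) expgS => E.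
by apply: (mulgI a); rewrite E mulg1.
Qed.

(* Determination of the order, the class and the orders of the generators *)
Local Close Scope group_scope.

Theorem theorem5p1 (p : nat) (alpha beta : int) :
  prime p -> alpha != 1%R -> beta != 1%R ->
  (3 < p \/ (p = 3 /\ (alpha %% 9)%Z != 7%R /\ (beta %% 9)%Z != 7%R)) ->
  let m := logn p `|(alpha - 1)%R|%N in
  let n := logn p `|(beta - 1)%R|%N in
  let l := logn p `|(alpha - beta)%R|%N in
  n <= m -> n = l -> 0 < n ->
  forall (gT : finGroupType) (A B : gT), is_Gab A B alpha beta ->
  forall P : {group gT}, P \in ('Syl_p([set: gT]))%g ->
    [/\ #|P| = p ^ (4 * n + m), nil_class P = 3,
        #[A.`_p]%g = p ^ (m + n), #[B.`_p]%g = p ^ (2 * n)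
      & #[([~ A, B]).`_p]%g = p ^ n].
Proof.
move=> p_pr alpha1 beta1 hp m n l nm nl n0 gT A B GAB P; rewrite inE => sylP.
have p_odd : odd p.
  by case: hp => [p3|[-> //]]; case: (even_prime p_pr) p3 => // ->.
(* Changing exponents modulo [T] preserves the relations in [gT], the valuations [m], [n], [l], and
   the residues modulo 9. The windows 2 and 1 below force [1 < j < i]. *)
pose T := (#|[set: gT]%g| * (p ^ (m + n).+1 * 9))%N.
have T0 : 0 < T by rewrite !muln_gt0 cardG_gt0 expn_gt0 prime_gt0.
have [i iT /andP[Ti _]] := nat_repr alpha 2 T0.
have [j jT /andP[Tj jT2]] := nat_repr beta 1 T0.
have ji : j < i := leq_trans jT2 Ti.
have dT k z : k %| T -> (T %| z)%Z -> (k %| z)%Z by move=> kT; apply: dvdz_trans.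
have gTT x : #[x : gT]%g %| T by rewrite dvdn_mulr // order_dvdG ?inE.
have pT k : k <= (m + n).+1 -> p ^ k %| T.
  by move=> kmn; rewrite dvdn_mull // dvdn_mulr // dvdn_exp2l.
have T2 : 2 <= T.
  by apply: leq_trans (prime_gt1 p_pr) (dvdn_leq T0 _); rewrite -(expn1 p) pT.
have j1 : 1 < j by apply: leq_trans Tj; rewrite mul1n.
have i1 : 1 < i := ltn_trans j1 ji.
have im : logn p i.-1 = m.
  have -> : i.-1 = `|(i%:Z - 1)%R|%N by lia.
  apply: logn_absz_cong; rewrite ?subr_eq0 //.
  rewrite (_ : _ - 1 - _ = i%:Z - alpha)%R; last by ring.
  by apply: dT iT; apply: pT; rewrite ltnS leq_addr.
have jn : logn p j.-1 = n.
  have -> : j.-1 = `|(j%:Z - 1)%R|%N by lia.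
  apply: logn_absz_cong; rewrite ?subr_eq0 //.
  rewrite (_ : _ - 1 - _ = j%:Z - beta)%R; last by ring.
  by apply: dT jT; apply: pT; rewrite ltnS leq_addl.
have ijn : logn p (i - j) = n.
  have -> : (i - j)%N = `|(i%:Z - j%:Z)%R|%N by lia.
  rewrite nl; apply: logn_absz_cong => //.
    (* By convention [logn p 0 = 0], so [alpha = beta] would give [n = 0]. *)
    by apply: contraTneq n0 => E; rewrite nl /l E logn0.
  rewrite -/l -nl.
  rewrite (_ : _ - _ - _ = (i%:Z - alpha) - (j%:Z - beta))%R; last by ring.
  by apply: dT (rpredB iT jT); apply: pT; rewrite ltnS leq_addl.
have gj : logn p (gap j j) = (2 * n)%N.
  rewrite -jn -{1 2}(prednK (ltnW j1)) logn_gap_self ?jn // prednK ?(ltnW j1) //.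
  case: hp => [|[p3 [_ /eqP b9]]]; [by left | right; split=> // j9; apply: b9].
  have : (9 %| (j%:Z - beta)%R)%Z by apply: dT jT; rewrite !dvdn_mull.
  by rewrite -eqz_mod_dvd modz_nat j9 => /eqP <-.
have AB : rels A B i j.
  case: (GAB) => _ [+ _]; apply: (proj1 (Grels_rels _ _)).
    exact: dT iT.
  exact: dT jT.
have defG : ([set: gT] = <<[set A; B]>>)%g by case: GAB.
have nilG : nilpotent <<[set A; B]>>%g := nilpotent_rels AB (ltnW i1) (ltnW j1).
rewrite defG in sylP.
have [ab defP ->] := sylow_gen2 AB nilG sylP.
have pP : (p.-group <<[set A.`_p; B.`_p]>>)%g by rewrite -defP (pHall_pgroup sylP).
have pi : p ^ m %| i.-1 by rewrite -im pfactor_dvdnn.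
have pj : p ^ n %| j.-1 by rewrite -jn pfactor_dvdnn.
have [||a1 c1 b1 leP] := is_Gab_lower GAB p_pr p_odd n0 nm (ltnW i1) (ltnW j1) pi pj.
- by apply: dT iT; apply: pT.
- by apply: dT jT; apply: pT.
have := upper_bounds ab p_pr p_odd pP; rewrite im jn.
case/(_ n0 nm ji ijn gj) => a2 b2 c2 geP class3.
have oa : #[A.`_p]%g = (p ^ (m + n))%N.
  by apply/eqP; rewrite eqn_dvd a1 order_dvdn a2 eqxx.
have ob : #[B.`_p]%g = (p ^ (2 * n))%N.
  by apply/eqP; rewrite eqn_dvd order_dvdn b2 eqxx mul2n -addnn.
split=> //; last by apply/eqP; rewrite eqn_dvd c1 order_dvdn c2 eqxx.
- rewrite defP; apply/eqP; rewrite eqn_leq geP (leq_trans _ leP) //.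
  have -> : #[B.`_p ^+ (p ^ n)]%g = p ^ n.
    rewrite orderXdiv ob mul2n -addnn expnD ?dvdn_mull // mulnK //.
    by rewrite expn_gt0 prime_gt0.
  by rewrite -expnD leq_pexp2l ?prime_gt0 //; lia.
rewrite defP; apply/eqP; rewrite eqn_leq class3 ltnNge; apply/negP.
(* Class at most 2 would make [p ^ (m + n)] divide [i.-1], whose valuation is only [m]. *)
move/(expg_eq1_nil_class_le2 ab (pgroup_nil pP) (ltnW i1))/eqP.
rewrite -order_dvdn oa pfactor_dvdn ?im //; last by rewrite -ltnS prednK // ltnW.
by rewrite -[X in _ <= X]addn0 leq_add2l leqNgt n0.
Qed.
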